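(* Let $\mathcal C$ be a binary cyclic code of length $n=2^m-1$, let $d^\perp$ be the minimum distance of its dual code, and let $b^{(0)}(x),\dots,b^{(L-1)}(x)$ be $L$ cyclically different dual codewords of minimal weight $d^\perp$, each with coefficient $1$ at $x^0$. Let $r(x)=c(x)+e(x)$ with $c(x)\in\mathcal C$ and $e(x)\in\mathbb F_2[x]/(x^n-1)$, let $w^{(\ell)}(x)=r(x)b^{(\ell)}(x) \bmod (x^n-1)$, and let $\Phi_j$ and $\Delta_j$ be the counting value and the bit-flipping value defined in the context. Then for every position $j\in\{0,1,\dots,n-1\}$, $$L\,d^\perp-2\,\Phi_j=\Delta_j .$$
   Context: All polynomials are elements of $\mathbb F_2[x]/(x^n-1)$, with indices of coefficients and exponents taken modulo $n$; $\mathrm{wt}$ denotes Hamming weight (number of nonzero coefficients) and $\mathrm{supp}$ the set of exponents of the nonzero coefficients. Dual codewords in polynomial form: $\mathcal C$ is generated by $g(x)\mid x^n-1$, and the dual code (in the polynomial convention used here) is the cyclic code generated by $h(x)=(x^n-1)/g(x)$, so that $c(x)b(x)=0 \bmod (x^n-1)$ for all $c(x)\in\mathcal C$ and all dual codewords $b(x)$. Two dual codewords are cyclically different if neither is a cyclic shift $x^i\,\cdot$ of the other. Write $w^{(\ell)}(x)=\sum_{i=0}^{n-1} w^{(\ell)}_i x^i$ with $w^{(\ell)}_i\in\{0,1\}$. The counting value at position $j$ is the integer $$\Phi_j=\sum_{\ell=0}^{L-1}\ \sum_{i\in \mathrm{supp}\, b^{(\ell)}(x)} w^{(\ell)}_{\,j+i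 \bmod n},$$ where the $w^{(\ell)}_i\in\{0,1\}$ are summed as integers. The bit-flipping value at position $j$ is the integer $$\Delta_j=\sum_{\ell=0}^{L-1}\Big(\mathrm{wt}\big(w^{(\ell)}(x)+x^j b^{(\ell)}(x)\big)-\mathrm{wt}\big(w^{(\ell)}(x)\big)\Big),$$ where the polynomial addition is over $\mathbb F_2$ modulo $x^n-1$. *)

(* Defs.v *)
From mathcomp Require Import all_boot all_order all_algebra qfpoly.

Set Implicit Arguments.
Unset Strict Implicit.
Unset Printing Implicit Defensive.

Import GRing.Theory Num.Theory.
Local Open Scope ring_scope.

(* F_2[x]/(x^n - 1).  {poly %/ p} is the quotient by mk_monic p, which is p
   itself only for p monic and nonconstant; here this means n > 0, see
   mk_monic_Xn1. *)
Notation cpoly n := {poly %/ ('X^n - 1 : {poly 'F_2})}.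

Lemma mk_monic_Xn1 (n : nat) :
  (0 < n)%N -> mk_monic ('X^n - 1 : {poly 'F_2}) = 'X^n - 1.
Proof.
by move=> n0; rewrite /mk_monic size_XnsubC // ltnS n0 monicXnsubC.
Qed.

Definition supp {n : nat} (u : cpoly n) : {set 'I_n} :=
  [set i : 'I_n | u`_i != 0].

Definition wt {n : nat} (u : cpoly n) : nat := #|supp u|.

Definition cyclic_code (n : nat) (g : {poly 'F_2}) : {set cpoly n} :=
  [set u * in_qpoly ('X^n - 1) g | u : cpoly n].

(* Dual for the bilinear form given by the polynomial product (see
   mul_dual_code), i.e. without reversal of the coordinates. *)
Definition dual_code (n : nat) (g : {poly 'F_2}) : {set cpoly n} :=
  cyclic_code n (('X^n - 1) %/ g).

Lemma mul_dual_code (n : nat) (g : {poly 'F_2}) (c b : cpoly n) :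
  (0 < n)%N -> g %| ('X^n - 1 : {poly 'F_2}) ->
  c \in cyclic_code n g -> b \in dual_code n g -> c * b = 0.
Proof.
move=> n0 /divpK gK /imsetP[u _ ->] /imsetP[v _ ->].
have gh0 : in_qpoly ('X^n - 1) g * in_qpoly ('X^n - 1) (('X^n - 1) %/ g) = 0.
  by rewrite -rmorphM mulrC gK; apply/val_inj;
     rewrite /= mk_monic_Xn1 // Pdiv.RingMonic.rmodpp ?monicXnsubC.
by rewrite mulrACA gh0 mulr0.
Qed.

(* Stated as a relation, since a code with a single codeword has no minimum
   distance. *)
Definition is_min_distance {n : nat} (D : {set cpoly n}) (d : nat) : Prop :=
  (exists u v, [/\ u \in D, v \in D, u != v & wt (u - v) = d]) /\
  (forall u v, u \in D -> v \in D -> u != v -> (d <= wt (u - v)%R)%N).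

Definition cyclically_different {n : nat} (u v : cpoly n) : Prop :=
  (forall i : nat, u != 'qX ^+ i * v) /\ (forall i : nat, v != 'qX ^+ i * u).

(* The coefficients in 'F_2 are read as the integers 0 and 1 through the
   coercion nat_of_ord. *)
Definition counting_value {n L : nat} (w b : 'I_L -> cpoly n) (j : 'I_n) : int :=
  \sum_(l < L) \sum_(i in supp (b l)) (nat_of_ord (w l)`_((j + i) %% n)%N)%:Z.

Definition bit_flipping_value {n L : nat} (w b : 'I_L -> cpoly n) (j : 'I_n)
  : int :=
  \sum_(l < L) ((wt (w l + 'qX ^+ j * b l))%:Z - (wt (w l))%:Z).

(* Main.v *)
(* Multiplication by x^j permutes the coefficients, so adding x^j b to w flips
   exactly the coefficients w_(j+i) with i in supp b.  Flipping a bit w_k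
   changes the weight by 1 - 2 w_k; summing over supp b gives
   wt b - 2 sum_i w_(j+i), and then one sums over the dual codewords. *)
Require Import Defs.
From mathcomp Require Import all_boot all_order all_algebra qfpoly.
Import GRing.Theory Num.Theory.
Local Open Scope ring_scope.

Section CyclicShift.

Variables (R : comNzRingType) (n : nat).
Hypothesis n_gt0 : (0 < n)%N.

Let h : {poly R} := 'X^n - 1.

Let mk_monic_h : mk_monic h = h.
Proof. by rewrite /mk_monic size_XnsubC // ltnS n_gt0 monicXnsubC. Qed.

Let size_mk_monic_h : size (mk_monic h) = n.+1.
Proof. by rewrite mk_monic_h size_XnsubC. Qed.

Lemma size_qpoly_Xn1 (u : {poly %/ h}) : (size u <= n)%N.
Proof. by rewrite -ltnS -size_mk_monic_h size_mk_monic. Qed.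

(** Since [h] vanishes in its own quotient, ['X^n] becomes 1, so exponents only matter modulo
    [n]. *)
Lemma in_qpoly_Xn_mod (k : nat) : in_qpoly h 'X^k = in_qpoly h 'X^(k %% n)%N.
Proof.
have Xn1 : in_qpoly h 'X^n = 1.
  have /eqP: in_qpoly h h = 0.
    apply/val_inj; rewrite /= [mk_monic _]mk_monic_h.
    by rewrite Pdiv.RingMonic.rmodpp ?monicXnsubC.
  by rewrite raddfB /= rmorph1 subr_eq0 => /eqP.
rewrite {1}(divn_eq k n) exprD mulnC exprM rmorphM rmorphXn /= Xn1.
by rewrite expr1n mul1r.
Qed.

Lemma coef_in_qpoly_Xn (k i : nat) : (in_qpoly h 'X^k)`_i = (i == k %% n)%N%:R.
Proof.
rewrite in_qpoly_Xn_mod in_qpoly_small ?coefXn //.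
by rewrite size_mk_monic_h size_polyXn ltnS ltn_pmod.
Qed.

Lemma coef_qX_exp_mul (u : {poly %/ h}) (j : nat) (i : 'I_n) :
  ('qX ^+ j * u)`_((j + i) %% n)%N = u`_i.
Proof.
(* As [u] has size at most [n], the sum of its first [n] monomials is already reduced modulo [h]. *)
have def_u : u = in_qpoly h (\sum_(k < n) u`_k *: 'X^k).
  rewrite -poly_def; apply/val_inj; rewrite /= Pdiv.CommonRing.rmodp_small.
    apply/polyP=> k; rewrite coef_poly.
    by case: ltnP => // /(leq_trans (size_qpoly_Xn1 u))/leq_sizeP ->.
  by rewrite (leq_ltn_trans (size_poly _ _)) ?[size _]size_mk_monic_h.
have -> : 'qX ^+ j * u = \sum_(k < n) u`_k *: in_qpoly h 'X^(j + k).
  rewrite {1}def_u -rmorphXn -rmorphM mulr_sumr raddf_sum.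
  by apply: eq_bigr => k _; rewrite -scalerAr -exprD [LHS]in_qpolyZ.
(* Only [k = i] contributes: [j + k] and [j + i] agree modulo [n] only if [k = i], both being below
   [n]. *)
rewrite coefn_sum (bigD1 i) //= coefZ coef_in_qpoly_Xn eqxx mulr1.
rewrite big1 ?addr0 // => k k'i.
rewrite coefZ coef_in_qpoly_Xn eqn_modDl !modn_small // eq_sym.
by rewrite [_ == _](negPf k'i) mulr0.
Qed.

End CyclicShift.

(** The map from [i] to [j + i] modulo [n] permutes the positions. Starting the count at [j] aligns
    it with the coefficients of ['qX ^+ j * b], whose entry there is [b_i]. *)
Lemma wt_sum_coef (n j : nat) (u : cpoly n) : (0 < n)%N ->
  wt u = (\sum_(i < n) nat_of_ord (u`_((j + i) %% n)%N)%R)%N.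
Proof.
move=> n_gt0; pose s (i : 'I_n) := Ordinal (ltn_pmod (j + i) n_gt0).
have s_inj : injective s.
  move=> i k /(congr1 val)/eqP; rewrite /= eqn_modDl !modn_small //.
  by move/eqP/val_inj.
rewrite /wt -sum1_card big_mkcond (reindex_inj s_inj) /=.
(* An element of ['F_2] is 0 or 1, so its integer value is the indicator of being nonzero. *)
by apply: eq_bigr => i _; rewrite inE /=; case: (_`__) => [[|[]]].
Qed.

Lemma wt_add_qX_exp_mul (n j : nat) (w b : cpoly n) : (0 < n)%N ->
  (wt (w + 'qX ^+ j * b))%:Z - (wt w)%:Z =
  (wt b)%:Z - 2 * \sum_(i in supp b) (nat_of_ord w`_((j + i) %% n)%N)%:Z.
Proof.
move=> n_gt0; rewrite (wt_sum_coef n j (w + _)) // (wt_sum_coef n j w) // /wt -sum1_card.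
rewrite !(big_morph Posz PoszD (erefl 0%:Z)) -sumrB mulr_sumr -sumrB [RHS]big_mkcond.
apply: eq_bigr => i _.
rewrite inE coefD coef_qX_exp_mul //.
(* Four cases of bits: both sides are 0 if [b_i] is 0, and 1 minus twice the bit of [w] if [b_i] is
   1. *)
by case: (b`_i) => [[|[]]] //; case: (w`__) => [[|[]]].
Qed.

Theorem lemma1 (m n : nat) (hm : (0 < m)%N) (hn : n = (2 ^ m - 1)%N)
    (g : {poly 'F_2}) (hg : g %| ('X^n - 1 : {poly 'F_2}))
    (d : nat) (hd : is_min_distance (dual_code n g) d)
    (L : nat) (b : 'I_L -> cpoly n)
    (hb_dual : forall l, b l \in dual_code n g)
    (hb_wt : forall l, wt (b l) = d)
    (hb_diff : forall l k, l != k -> cyclically_different (b l) (b k))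
    (hb_0 : forall l, (b l)`_0 = 1)
    (c e r : cpoly n) (hc : c \in cyclic_code n g) (hr : r = c + e)
    (w : 'I_L -> cpoly n) (hw : forall l, w l = r * b l)
    (j : 'I_n) :
  (L%:Z * d%:Z) - 2 * counting_value w b j = bit_flipping_value w b j.
Proof.
have n_gt0 : (0 < n)%N := leq_ltn_trans (leq0n j) (ltn_ord j).
rewrite /counting_value /bit_flipping_value.
under [RHS]eq_bigr => l _ do rewrite wt_add_qX_exp_mul // hb_wt.
(* The constant [d] summed over ['I_L] is the multiple [d *+ L]; [natz] recasts the integer [L] as a
   multiple of 1 to match it. *)
by rewrite sumrB -mulr_sumr sumr_const card_ord -[L%:Z]natz mulr_natl.
Qed.
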